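(* Let $n\geq 1$ be an integer, let $m=2n+1\geq 3$, let $\{x_j\}$ be a nondecreasing sequence of real numbers (knots), and let $j$ be an index such that $x_j,\ldots,x_{j+m}$ belong to the sequence. Let $w^T_{j,m}$ and $w^H_{j,m}$ be the trigonometric and hyperbolic normalization weights and let $\mathcal{S}_n$ be the set of sign vectors, all as defined in the context. (Trigonometric case) If $x_{i+m}-x_i<\pi$ for all $i$, then $$ w^T_{j,m}=\frac{1}{|\mathcal{S}_n|}\sum_{\boldsymbol{s}\in\mathcal{S}_n}\cos\left(\frac{-x_{j+1}+\sum_{k=1}^{2n-1}s_k\,x_{j+k+1}}{2}\right). $$ (Hyperbolic case) Without any restriction on the knot distances, $$ w^H_{j,m}=\frac{1}{|\mathcal{S}_n|}\sum_{\boldsymbol{s}\in\mathcal{S}_n}\cosh\left(\frac{-x_{j+1}+\sum_{k=1}^{2n-1}s_k\,x_{j+k+1}}{2}\right). $$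
   Context: For an integer $n\geq 1$, let $\mathcal{Q}_n$ be the set of vectors $\boldsymbol{q}=(q_1,\ldots,q_{2n})\in\mathbb{Z}^{2n}$ consisting of all permutations of $(1,2,\ldots,2n)$, so $|\mathcal{Q}_n|=(2n)!$. For $m=2n+1\geq 3$, the normalization weights are defined by $$ w^T_{j,m}=\frac{1}{|\mathcal{Q}_n|}\sum_{\boldsymbol{q}\in\mathcal{Q}_n}\prod_{k=1}^{n}\cos\left(\frac{x_{j+q_{2k}}-x_{j+q_{2k-1}}}{2}\right), \qquad w^H_{j,m}=\frac{1}{|\mathcal{Q}_n|}\sum_{\boldsymbol{q}\in\mathcal{Q}_n}\prod_{k=1}^{n}\cosh\left(\frac{x_{j+q_{2k}}-x_{j+q_{2k-1}}}{2}\right). $$ Let $\mathcal{S}_n$ be the set of vectors $\boldsymbol{s}=(s_1,\ldots,s_{2n-1})\in\{-1,1\}^{2n-1}$ consisting of all distinct permutations of the vector with $n-1$ entries equal to $-1$ and $n$ entries equal to $1$; thus $|\mathcal{S}_n|=\binom{2n-1}{n-1}=\frac12\binom{2n}{n}$. *)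

(* Defs.v *)
From mathcomp Require Import all_boot all_order all_algebra.
From mathcomp Require Import all_reals all_analysis.
Set Implicit Arguments.
Unset Strict Implicit.
Unset Printing Implicit Defensive.
Import Order.TTheory GRing.Theory Num.Theory.
Local Open Scope ring_scope.

Definition cosh (R : realType) (t : R) : R := (expR t + expR (- t)) / 2.

(* Vectors are stored as sequences but their entries are numbered from 1. *)
Definition entry (v : seq int) (k : nat) : int := nth 0 v k.-1.

(* [permutations] lists the distinct rearrangements of a sequence, each once,
   also when the sequence has repeated entries. *)
Definition Q_ (n : nat) : seq (seq int) :=
  permutations [seq k%:Z | k <- iota 1 (2 * n)].

Definition S_ (n : nat) : seq (seq int) :=
  permutations (nseq (n - 1) (-1) ++ nseq n 1).

(* [wT n x j] and [wH n x j] are the weights of index (j, m) for m = 2n+1. *)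
Definition wT (R : realType) (n : nat) (x : int -> R) (j : int) : R :=
  (size (Q_ n))%:R^-1 *
  \sum_(q <- Q_ n) \prod_(1 <= k < n.+1)
    cos ((x (j + entry q (2 * k)) - x (j + entry q (2 * k - 1))) / 2).

Definition wH (R : realType) (n : nat) (x : int -> R) (j : int) : R :=
  (size (Q_ n))%:R^-1 *
  \sum_(q <- Q_ n) \prod_(1 <= k < n.+1)
    cosh ((x (j + entry q (2 * k)) - x (j + entry q (2 * k - 1))) / 2).

(* The argument of cos and cosh in the sums over sign vectors. *)
Definition signed_arg (R : realType) (n : nat) (x : int -> R) (j : int)
    (s : seq int) : R :=
  (- x (j + 1) +
   \sum_(1 <= k < 2 * n) (entry s k)%:~R * x (j + k%:Z + 1)) / 2.

(* Main.v *)
(* The weights and the right-hand sides are averages of c (t) = cos (t/2) or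
   cosh (t/2), and both functions satisfy 2 c(a) c(b) = c(a + b) + c(a - b).
   When the product over pairs is expanded into a sum over sign choices, each
   choice gives the same sum over permutations, because exchanging q_(2k-1) and
   q_(2k) is a bijection.  So the weight is the average of c over all balanced
   signings of the 2n knots, and since c is even one may fix the sign of the
   first knot. *)
Require Import Defs.
From mathcomp Require Import all_boot all_order all_algebra all_fingroup.
From mathcomp Require Import all_reals all_analysis.
From mathcomp Require Import ring zify.
Import Order.TTheory GRing.Theory Num.Theory.
Local Open Scope ring_scope.

Lemma sum_permutations (V : nmodType) (T : eqType) (N : nat) (t : N.-tuple T)
    (F : seq T -> V) :
  \sum_(p : 'S_N) F [tuple tnth t (p i) | i < N] =
  (\sum_(s <- permutations t) F s) *+
    #|[pred p : 'S_N | [tuple tnth t (p i) | i < N] == t]|.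
Proof.
pose act (p : 'S_N) : seq T := [tuple tnth t (p i) | i < N].
have actE p : act p \in permutations t.
  by rewrite mem_permutations; apply/tuple_permP; exists p.
(* [permutations t] is duplicate-free, so the inner sum has exactly one term. Exchanging the sums
   then groups the [p] by the rearrangement they produce. *)
transitivity (\sum_(p : 'S_N) \sum_(s <- permutations t | s == act p) F s).
  apply: eq_bigr => p _; rewrite -big_filter filter_pred1_uniq ?big_seq1 //.
  exact: permutations_uniq.
rewrite (exchange_big_dep xpredT) //= -sumrMnl.
rewrite !big_seq; apply: eq_bigr => s.
rewrite mem_permutations => /tuple_permP[r ->{s}].
(* The permutations carrying t to a given s form a coset of the stabiliser of t. *)
rewrite sumr_const; congr (_ *+ _).
rewrite -!sum1_card (reindex_inj (mulgI r)) /=.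
have eq_act p q : (act p == act q) = [forall i, tnth t (p i) == tnth t (q i)].
  apply/eqP/forallP => [/val_inj e i|e].
    by move/(congr1 (fun u => tnth u i)): e; rewrite !tnth_mktuple => ->.
  by congr val; apply: eq_from_tnth => i; rewrite !tnth_mktuple (eqP (e i)).
have act1 : act 1%g = t.
  congr val; apply: eq_from_tnth => i.
  by rewrite tnth_mktuple perm1.
apply: eq_bigl => p; rewrite !inE -(inj_eq val_inj) /=.
rewrite -[X in _ = (_ == X)]act1.
change ((act r == act (r * p)%g) = (act p == act 1%g)); rewrite !eq_act.
apply/forallP/forallP => e i.
  by have := e ((r^-1)%g i); rewrite permM permKV perm1 eq_sym.
by have := e (r i); rewrite permM perm1 eq_sym.
Qed.

(** Turns averages over rearrangements, with or without repeated entries, into averages over the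
    symmetric group, where variables can be changed by multiplication and inversion. *)
Lemma avg_permutations (F : numFieldType) (T : eqType) (N : nat)
    (t : N.-tuple T) (f : seq T -> F) :
  (size (permutations t))%:R^-1 * \sum_(s <- permutations t) f s =
  N`!%:R^-1 * \sum_(p : 'S_N) f [tuple tnth t (p i) | i < N].
Proof.
(* The constant summand 1 shows that the multiplicity [k] times the number of rearrangements is
   [N!], so [k] cancels. *)
have := sum_permutations nat T N t (fun=> 1%N).
rewrite sum1_card card_Sn sum1_size => E.
rewrite sum_permutations; set k := #|_| in E *.
have {}E : N`! = (size (permutations t) * k)%N by rewrite E -mulr_natr natn.
have := fact_gt0 N; rewrite E muln_gt0 => /andP[s0 k0].
rewrite -mulr_natl natrM; field.
by rewrite !pnatr_eq0 -!lt0n s0 k0.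
Qed.

Section EvenProductToSum.
Variables (F : numFieldType) (c : F -> F).
Hypothesis cD : forall a b, c a * c b = (c (a + b) + c (a - b)) / 2.

(** Induction on the pairs: [E] accumulates the differences already absorbed into the argument of
    [c]. It has to be invariant under the transpositions of the pairs still to come, and it stays so
    because the pairs are disjoint. *)
Lemma sum_perm_prod_pairs (I : finType) (K : eqType) (ks : seq K) (a b : K -> I)
    (u : I -> F) (E : {perm I} -> F) :
  injective a -> injective b -> (forall k l, a k != b l) -> uniq ks ->
  (forall k p, k \in ks -> E (tperm (a k) (b k) * p)%g = E p) ->
  \sum_(p : {perm I}) c (E p) * \prod_(k <- ks) c (u (p (a k)) - u (p (b k))) =
  \sum_(p : {perm I}) c (E p + \sum_(k <- ks) (u (p (a k)) - u (p (b k)))).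
Proof.
move=> inja injb neq_ab; elim: ks E => [|k ks IH] E.
  by move=> _ _; apply: eq_bigr => p _; rewrite !big_nil mulr1 addr0.
rewrite cons_uniq => /andP[kks uks] invE.
pose d k p := u (p (a k)) - u (p (b k)).
have d_neq l m p : m != l -> d m (tperm (a l) (b l) * p)%g = d m p.
  move=> ml; rewrite /d !permM.
  by rewrite !tpermD ?(inj_eq inja) ?(inj_eq injb) 1?[_ == a _]eq_sym ?neq_ab
    1?eq_sym.
have d_eq p : d k (tperm (a k) (b k) * p)%g = - d k p.
  by rewrite /d !permM tpermL tpermR opprB.
(* Left multiplication by the transposition of [a k] and [b k] reverses the sign of [d k] and fixes
   [E] and all other differences. *)
have swap : \sum_p c (E p - d k p) * \prod_(l <- ks) c (d l p) =
            \sum_p c (E p + d k p) * \prod_(l <- ks) c (d l p).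
  rewrite (reindex_inj (mulgI (tperm (a k) (b k)))); apply: eq_bigr => p _ /=.
  rewrite invE ?mem_head // d_eq opprK; congr (_ * _).
  rewrite !big_seq; apply: eq_bigr => l lks; rewrite d_neq //.
  by apply: contraNneq kks => <-.
transitivity (\sum_p c (E p + d k p) * \prod_(l <- ks) c (d l p)).
  set X := RHS; have -> : X = (X + X) / 2 by field.
  rewrite {2}/X -swap {}/X.
  rewrite -big_split /= mulr_suml; apply: eq_bigr => p _.
  by rewrite big_cons mulrA cD -/(d k p); field.
rewrite (IH (fun p => E p + d k p)) // => [|l p lks].
  by apply: eq_bigr => p _; rewrite big_cons -addrA.
rewrite invE ?inE ?lks ?orbT // d_neq //.
by apply: contraNneq kks => ->.
Qed.

End EvenProductToSum.

(** Positions count from 0 here: the entry numbered 2k sits at an odd position and has sign 1 in the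
    k-th difference. *)
Definition alt_sign (i : nat) : int := if odd i then 1 else -1.

Lemma perm_alt_sign (n : nat) :
  perm_eq (mkseq alt_sign (2 * n)) (nseq n (-1) ++ nseq n 1).
Proof.
elim: n => [|n IH] //.
rewrite mulnS addnC /mkseq iotaD map_cat /alt_sign /= add0n mul2n odd_double.
apply/seq.permP => P; move/seq.permP: IH => /(_ P).
by rewrite mul2n !count_cat => ->; rewrite /= count_cat /= !count_nseq; lia.
Qed.

(** Balanced sign vectors are split by their first sign; negation exchanges the two classes. *)
Lemma perm_balanced (n : nat) :
  perm_eq (permutations (-1 :: (nseq n (-1) ++ nseq n.+1 1)))
    ([seq -1 :: s | s <- S_ n.+1] ++ [seq 1 :: map -%R s | s <- S_ n.+1]).
Proof.
rewrite /S_ subn1 /=; set t := nseq n _ ++ _.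
have tN : perm_eq (1 :: map -%R t) (-1 :: t).
  apply/seq.permP => P; rewrite /t map_cat /= !map_nseq opprK !count_cat /= !count_nseq.
  by rewrite addnA [RHS]addnA addnC.
apply: uniq_perm; first exact: permutations_uniq.
  rewrite cat_uniq !map_inj_uniq ?permutations_uniq //=; first last.
  - by move=> s1 s2 [].
  - by move=> s1 s2 [] /(inj_map oppr_inj).
  by rewrite andbT; apply/hasPn => _ /mapP[s _ ->]; apply/mapP => -[].
move=> s; rewrite mem_permutations mem_cat; apply/idP/orP.
  case: s => [|z s] e; first by have := perm_size e.
  have : (z == -1) || (z == 1).
    have := perm_mem e z; rewrite mem_head /t !(inE, mem_cat, mem_nseq).
    by case: (z == -1); case: (z == 1); rewrite ?andbF.
  case/orP=> /eqP z1.
  - left; rewrite z1; apply: map_f; rewrite mem_permutations.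
    by move: e; rewrite z1 perm_cons.
  - right; rewrite z1; apply/mapP; exists (map -%R s).
      rewrite mem_permutations -(perm_cons (-1)).
      apply: perm_trans tN; move: e; rewrite z1 => /(perm_map -%R) /=.
      by rewrite opprK.
    by rewrite (mapK (@opprK _)).
case=> /mapP[r]; rewrite mem_permutations => rt ->.
  by rewrite perm_cons.
by apply: perm_trans tN; rewrite perm_cons perm_map.
Qed.

Section Weights.
Variables (R : realType) (c : R -> R).
Hypothesis c0 : c 0 = 1.
Hypothesis cN : forall a, c (- a) = c a.
Hypothesis cD : forall a b, c a * c b = (c (a + b) + c (a - b)) / 2.

Lemma avg_balanced (n : nat) (y : nat -> R) :
  (size (permutations (mkseq alt_sign (2 * n.+1))))%:R^-1 *
    \sum_(s <- permutations (mkseq alt_sign (2 * n.+1)))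
      c (\sum_(i < 2 * n.+1) (nth 0 s i)%:~R * y i) =
  (size (S_ n.+1))%:R^-1 * \sum_(s <- S_ n.+1)
      c (- y 0%N + \sum_(1 <= k < 2 * n.+1) (entry s k)%:~R * y k).
Proof.
have e := perm_trans (perm_permutations (perm_alt_sign n.+1)) (perm_balanced n).
rewrite (perm_size e) (perm_big _ e) big_cat !big_map size_cat !size_map.
have argE z s : \sum_(i < 2 * n.+1) (nth 0 (z :: s) i)%:~R * y i =
    z%:~R * y 0%N + \sum_(1 <= k < 2 * n.+1) (entry s k)%:~R * y k.
  rewrite -(big_mkord xpredT (fun i => (nth 0 (z :: s) i)%:~R * y i)).
  rewrite big_ltn //=; congr (_ + _); rewrite !big_nat; apply: eq_bigr => k.
  by case: k.
have eqc : \sum_(s <- S_ n.+1)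
    c (\sum_(i < 2 * n.+1) (nth 0 (1 :: map -%R s) i)%:~R * y i) =
  \sum_(s <- S_ n.+1)
    c (\sum_(i < 2 * n.+1) (nth 0 (-1 :: s) i)%:~R * y i).
  apply: eq_bigr => s _; rewrite -cN; congr c; rewrite -sumrN.
  apply: eq_bigr => -[[|i] /= _] _; first by rewrite mulrN1z mulNr.
  (* Nothing is assumed here about the length of [s]; past its end both sides read the default 0,
     which is its own negative. *)
  have [lt_is|le_si] := ltnP i (size s).
    by rewrite (nth_map 0) // mulrNz mulNr opprK.
  by rewrite !nth_default ?size_map // mul0r oppr0.
rewrite /= eqc -mulr2n -(mulr_natl _ 2) addnn -muln2 natrM invfM.
rewrite -mulrA mulKf ?pnatr_eq0 //.
by congr (_ * _); apply: eq_bigr => s _; rewrite argE mulrN1z mulN1r.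
Qed.

Lemma avg_prod_pairs (n : nat) (g : int -> R) : (0 < n)%N ->
  (size (Q_ n))%:R^-1 * \sum_(q <- Q_ n)
     \prod_(1 <= k < n.+1) c (g (entry q (2 * k)) - g (entry q (2 * k - 1))) =
  (size (S_ n))%:R^-1 * \sum_(s <- S_ n)
     c (- g 1 + \sum_(1 <= k < 2 * n) (entry s k)%:~R * g (k%:Z + 1)).
Proof.
case: n => // n _; set N := (2 * n.+1)%N.
have sizeQ : size [seq k%:Z | k <- iota 1 N] == N by rewrite size_map size_iota.
rewrite /Q_ -/N; pose t := Tuple sizeQ.
rewrite -[map _ _]/(tval t) avg_permutations.
pose y i := g (i%:Z + 1).
have oddP (k : 'I_n.+1) : (2 * k + 1 < N)%N by case: k => k /=; rewrite /N; lia.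
have evenP (k : 'I_n.+1) : (2 * k < N)%N by case: k => k /=; rewrite /N; lia.
(* With [k] counted from 0, these are the positions of the entries numbered 2k+2 and 2k+1. *)
pose a k := Ordinal (oddP k); pose b k := Ordinal (evenP k).
have tE (p : 'S_N) (i : 'I_N) :
    g (nth 0 [tuple tnth t (p i) | i < N] i) = y (p i).
  rewrite -tnth_nth tnth_mktuple (tnth_nth 0).
  rewrite -[nth _ _ _]/(nth 0 [seq k%:Z | k <- iota 1 N] (p i)).
  by rewrite (nth_map 0%N) ?size_iota // nth_iota //; congr g; lia.
transitivity (N`!%:R^-1 *
    \sum_(p : 'S_N) c (\sum_(k < n.+1) (y (p (a k)) - y (p (b k))))).
  congr (_ * _).
  (* The accumulator starts at 0, and [c 0 = 1] makes the extra factor harmless. *)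
  under [RHS]eq_bigr do rewrite -[X in c X]add0r.
  rewrite -(@sum_perm_prod_pairs _ c cD 'I_N 'I_n.+1 (index_enum _) a b
    (fun i => y i) (fun=> 0)) //.
  - apply: eq_bigr => p _; rewrite c0 mul1r big_add1 /= big_mkord.
    apply: eq_bigr => k _; rewrite -!tE /entry /=.
    by congr (c (g (nth _ _ _) - g (nth _ _ _))); lia.
  - by move=> k l /(congr1 val) /= e; apply: val_inj => /=; lia.
  - by move=> k l /(congr1 val) /= e; apply: val_inj => /=; lia.
  - by move=> k l; rewrite -val_eqE /=; lia.
  - exact: index_enum_uniq.
rewrite -(avg_balanced n y).
have sizeA : size (mkseq alt_sign N) == N by rewrite size_mkseq.
rewrite -[mkseq _ _]/(tval (Tuple sizeA)) avg_permutations; congr (_ * _).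
(* Permuting the knots under fixed alternating signs amounts to permuting the signs over fixed knots
   by the inverse permutation. *)
rewrite (reindex_inj invg_inj); apply: eq_bigr => p _; congr c.
transitivity (\sum_(i < N) (alt_sign i)%:~R * y (p^-1 i)%g); last first.
  rewrite (reindex_inj (@perm_inj _ p)); apply: eq_bigr => i _.
  by rewrite permK -tnth_nth tnth_mktuple (tnth_nth 0) nth_mkseq.
have pairs (f : nat -> R) m :
    \sum_(i < 2 * m) f i = \sum_(k < m) (f (2 * k)%N + f (2 * k + 1)%N).
  elim: m => [|m IH]; first by rewrite muln0 !big_ord0.
  by rewrite mulnS addnC addn2 !big_ord_recr /= IH addrA addn1.
(* [pairs] needs a function on all of [nat], so the summand is extended by 0 beyond [N]. *)
pose f i := if insub i is Some i' then
  (alt_sign i)%:~R * y ((p^-1)%g (i' : 'I_N)) else 0.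
transitivity (\sum_(i < N) f i).
  rewrite pairs; apply: eq_bigr => k _.
  rewrite /f (insubT (ltn^~ N) (evenP k)) (insubT (ltn^~ N) (oddP k)).
  by rewrite /alt_sign oddD oddM /= mulrN1z mulN1r mul1r addrC.
by apply: eq_bigr => i _; rewrite /f valK.
Qed.

End Weights.

Lemma cos_half_prod (R : realType) (a b : R) :
  cos (a / 2) * cos (b / 2) = (cos ((a + b) / 2) + cos ((a - b) / 2)) / 2.
Proof. by rewrite [(a + b) / 2]mulrDl [(a - b) / 2]mulrBl cosD cosB; field. Qed.

Lemma cosh_half_prod (R : realType) (a b : R) :
  cosh (a / 2) * cosh (b / 2) = (cosh ((a + b) / 2) + cosh ((a - b) / 2)) / 2.
Proof.
by rewrite /cosh [(a + b) / 2]mulrDl [(a - b) / 2]mulrBl !opprD opprK !expRD; field.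
Qed.

(* The knots are the x i with i in I, a finite or infinite interval of
   integers; the values of x outside I are irrelevant. *)
Theorem theorem3p1 (R : realType) (n m : nat) (hn : (1 <= n)%N)
    (hm : m = (2 * n + 1)%N)
    (I : interval int) (x : int -> R)
    (x_nondecreasing : {in I &, {homo x : i k / i <= k}})
    (j : int) (hj : j \in I) (hjm : j + m%:Z \in I) :
  ((forall i : int, i \in I -> i + m%:Z \in I -> x (i + m%:Z) - x i < pi) ->
     wT n x j =
       (size (S_ n))%:R^-1 * \sum_(s <- S_ n) cos (signed_arg n x j s)) /\
  wH n x j =
    (size (S_ n))%:R^-1 * \sum_(s <- S_ n) cosh (signed_arg n x j s).
Proof.
have shift (s : seq int) : signed_arg n x j s = (- x (j + 1) +
    \sum_(1 <= k < 2 * n) (entry s k)%:~R * x (j + (k%:Z + 1))) / 2.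
  by rewrite /signed_arg; under eq_bigr do rewrite -addrA.
split=> [_|].
  under eq_bigr do rewrite shift.
  apply: (@avg_prod_pairs R (fun t => cos (t / 2)) _ _ _ n (fun z => x (j + z))) => //.
  - by rewrite mul0r cos0.
  - by move=> a; rewrite mulNr cosN.
  - exact: cos_half_prod.
under eq_bigr do rewrite shift.
apply: (@avg_prod_pairs R (fun t => cosh (t / 2)) _ _ _ n (fun z => x (j + z))) => //.
- by rewrite /cosh mul0r oppr0 expR0; field.
- by move=> a; rewrite /cosh mulNr opprK addrC.
- exact: cosh_half_prod.
Qed.
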